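(* Let $(\Omega,\mathcal F,\mathbb P)$ be an atomless probability space, let $p\in(0,1)$, $q\in[1,\infty)$, and let $\rho:L^q\to\mathbb R$ be a risk measure that is continuous with respect to the norm $\|X\|_q=(\mathbb E[|X|^q])^{1/q}$. Put $\mathbb H=\{(x,y)\in\mathbb R^2:x\ge y\}$. Then: (i) $\rho$ satisfies [$p$-CA] if and only if there is a continuous function $f:\mathbb H\to\mathbb R$, increasing in its first argument, such that $\rho(X)=f(\mathrm{ES}_p(X),\mathbb E[X])$ for all $X\in L^q$. (ii) $\rho$ satisfies [M] and [$p$-CA] if and only if there is a continuous function $f:\mathbb H\to\mathbb R$, increasing in both arguments, such that $\rho(X)=f(\mathrm{ES}_p(X),\mathbb E[X])$ for all $X\in L^q$.
   Context: $(\Omega,\mathcal F,\mathbb P)$ is atomless; $L^q$ is the space of random variables $X$ with $\mathbb E[|X|^q]<\infty$. A risk measure is simply a functional on this space. ''Increasing'' means non-strictly increasing. $X\overset{d}{=}Y$ means equality in law. For $p\in(0,1)$, $\mathrm{VaR}_p(X)=\inf\{x\in\mathbb R:\mathbb P(X\le x)\ge p\}$ and $\mathrm{ES}_p(X)=\frac1{1-p}\int_p^1\mathrm{VaR}_s(X)\,ds$. A tail event of a random variable $X$ is an event $A\in\mathcal F$ with $0<\mathbb P(A)<1$ such that $X(\omega)\ge X(\omega')$ for a.s. all $\omega\in A$ and $\omega'\in A^c$. A $p$-tail event of $X$ is a tail event of $X$ with probability $1-p$. A random vector is $p$-concentrated if its components share a common $p$-tail event. [M]: $\rho(X)\le\rho(Y)$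 whenever $X\le Y$ pointwise. [$p$-CA]: $\rho(X+Y)\le\rho(X'+Y')$ for all $X,Y,X',Y'\in L^q$ such that $(X',Y')$ is $p$-concentrated, $X\overset{d}{=}X'$ and $Y\overset{d}{=}Y'$. *)

(* Defs.v *)
(* MathComp-Analysis. *)
From HB Require Import structures.
From mathcomp Require Import all_boot all_order all_algebra.
From mathcomp Require Import all_classical all_reals all_analysis.

Set Implicit Arguments.
Unset Strict Implicit.
Unset Printing Implicit Defensive.

Import Order.TTheory GRing.Theory Num.Theory.
Import numFieldNormedType.Exports.

Local Open Scope classical_set_scope.
Local Open Scope ring_scope.

Section defs.
Context {d : measure_display} {T : measurableType d} {R : realType}.
Variable P : probability T R.

Definition atomless : Prop :=
  forall A : set T, measurable A -> (0 < P A)%E ->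
    exists B : set T,
      [/\ measurable B, B `<=` A, (0 < P B)%E & (P B < P A)%E].

(* A measure is unconstrained outside the sigma-algebra, hence the restriction
   to measurable sets. *)
Definition eq_in_law (X Y : {RV P >-> R}) : Prop :=
  forall B : set R, measurable B -> distribution P X B = distribution P Y B.

Definition VaR (p : R) (X : T -> R) : R :=
  inf [set x : R | (p%:E <= P [set w | (X w <= x)%R])%E].

(* VaR is only meaningful at levels in ]0, 1[, so the (Lebesgue-null) endpoints
   of [p, 1] are left out of the integral. *)
Definition ES (p : R) (X : T -> R) : R :=
  (1 - p)^-1 * \int[lebesgue_measure]_(s in `]p, 1[) VaR s X.

Definition tail_event (X : T -> R) (A : set T) : Prop :=
  [/\ measurable A, (0 < P A)%E, (P A < 1)%E &
      \forall w \ae P, \forall w' \ae P, A w -> (~` A) w' -> X w' <= X w].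

Definition p_tail_event (p : R) (X : T -> R) (A : set T) : Prop :=
  tail_event X A /\ P A = (1 - p)%:E.

Definition p_concentrated (p : R) (X Y : T -> R) : Prop :=
  exists A : set T, p_tail_event p X A /\ p_tail_event p Y A.

(* [LfunType P hq] is the type of random variables with finite L^q-norm, not
   quotiented by almost sure equality; the library does not equip it with a
   topology. *)
Section risk_measure.
Variables (q : R) (hq : (1 <= q%:E)%E).
Variable rho : LfunType P hq -> R.

Definition Lq_continuous : Prop :=
  forall (X : LfunType P hq) (e : R), 0 < e ->
    exists2 delta : R, 0 < delta &
      forall Y : LfunType P hq,
        ('N[P]_(q%:E)[EFin \o (Y - X)%R] < delta%:E)%E ->
        `|rho Y - rho X| < e.

Definition monotone_rm : Prop :=
  forall X Y : LfunType P hq, (forall w, X w <= Y w) -> rho X <= rho Y.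

Definition p_CA (p : R) : Prop :=
  forall X Y X' Y' : LfunType P hq,
    p_concentrated p X' Y' -> eq_in_law X X' -> eq_in_law Y Y' ->
    rho (X + Y) <= rho (X' + Y').

End risk_measure.

End defs.

Section halfplane.
Context {R : realType}.

Definition HH : set (R * R) := [set z | z.2 <= z.1].

(* Functions on HH are represented by total functions on R * R whose values
   outside HH are irrelevant. *)
Definition increasing_fst (f : R * R -> R) : Prop :=
  forall x x' y : R, HH (x, y) -> HH (x', y) -> x <= x' -> f (x, y) <= f (x', y).

Definition increasing_snd (f : R * R -> R) : Prop :=
  forall x y y' : R, HH (x, y) -> HH (x, y') -> y <= y' -> f (x, y) <= f (x, y').

End halfplane.

Arguments HH R : clear implicits.

(* Main.v *)
(* The proof rests on a swapping principle. If X, X' and Y share a tail event A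
   of probability 1 - p and X, X' have the same law, then [p-CA] applied both
   ways gives rho (X + Y) = rho (X' + Y). Hence a positive multiple of the
   indicator of an event B inside A may be cut into n equal slices, and the
   slices moved around inside A; when they are spread evenly they differ from
   the constant P(B) / P(A) on A by O(1/n) in sup norm. By continuity X may
   therefore be averaged over A, and likewise over the complement of A, so that
   rho (X) depends only on the two averages, that is on ES_p(X) and E[X].
   For monotonicity in the first argument, let B in A and C outside A have the
   same probability: k 1_B and k 1_C have the same law, and 1_B is concentrated
   on A, so that rho (Y) = rho ((Y - k 1_C) + k 1_C) <= rho (Y - k 1_C + k 1_B),
   where the right-hand side has the same mean and a larger ES_p. *)
Require Import Defs.
From HB Require Import structures.
From mathcomp Require Import all_boot all_order all_algebra finmap.
From mathcomp Require Import all_classical all_reals all_analysis.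
From mathcomp Require Import measurable_realfun ring lra.

Set Implicit Arguments.
Unset Strict Implicit.
Unset Printing Implicit Defensive.

Import Order.TTheory GRing.Theory Num.Theory.
Import numFieldNormedType.Exports.

Local Open Scope classical_set_scope.
Local Open Scope ring_scope.

(** * Probabilities as real numbers, and atomless spaces *)

Section real_valued_probability.
Context {d : measure_display} {T : measurableType d} {R : realType}.
Variable P : probability T R.
Implicit Types A B C : set T.

Definition pr A : R := fine (P A).

Lemma prE A : measurable A -> P A = (pr A)%:E.
Proof. by move=> mA; rewrite /pr fineK// fin_num_measure. Qed.

Lemma pr_ge0 A : 0 <= pr A.
Proof. exact: fine_ge0. Qed.

Lemma pr_setT : pr setT = 1.
Proof. by rewrite /pr probability_setT. Qed.

Lemma prU A B : measurable A -> measurable B -> A `&` B = set0 ->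
  pr (A `|` B) = pr A + pr B.
Proof.
move=> mA mB AB; apply: EFin_inj.
by rewrite EFinD -!prE// ?measureU//; exact: measurableU.
Qed.

Lemma prD A B : measurable A -> measurable B -> B `<=` A ->
  pr (A `\` B) = pr A - pr B.
Proof.
move=> mA mB BA; apply/eqP; rewrite eq_sym subr_eq; apply/eqP.
by rewrite -prU ?setDKU// ?setDKI//; exact: measurableD.
Qed.

Lemma le_prU A B : measurable A -> measurable B ->
  pr (A `|` B) <= pr A + pr B.
Proof.
move=> mA mB; rewrite -lee_fin EFinD -!prE//; last exact: measurableU.
exact: measureU2.
Qed.

Lemma prID A B : measurable A -> measurable B ->
  pr A = pr (A `&` B) + pr (A `\` B).
Proof.
move=> mA mB; rewrite -prU ?setUIDK//; last 3 first.
- exact: measurableI.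
- exact: measurableD.
- by rewrite setDE setIACA setICr setI0.
Qed.

Lemma prC A : measurable A -> pr (~` A) = 1 - pr A.
Proof. by move=> mA; rewrite -setTD prD// pr_setT. Qed.

Lemma le_pr A B : measurable A -> measurable B -> A `<=` B -> pr A <= pr B.
Proof.
by move=> mA mB AB; rewrite -lee_fin -!prE//; apply: le_measure; rewrite ?inE.
Qed.

Lemma pr_le1 A : measurable A -> pr A <= 1.
Proof. by move=> mA; rewrite -pr_setT le_pr. Qed.

Hypothesis hP : atomless P.

(** Atomlessness splits [A] into two pieces of positive probability, and the smaller piece has at
    most half of the mass. *)
Lemma atomless_half A : measurable A -> 0 < pr A ->
  exists B, [/\ measurable B, B `<=` A, 0 < pr B & pr B <= pr A / 2].
Proof.
move=> mA A0.
have [|B [mB BA]] := hP mA; first by rewrite prE ?lte_fin.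
rewrite !prE// !lte_fin => B0 BltA.
have [h|h] := leP (pr B) (pr A / 2); first by exists B.
exists (A `\` B); rewrite prD//; split => //.
- exact: measurableD.
- by rewrite subr_gt0.
- by rewrite lerBlDr; lra.
Qed.

(** Halving [n] times leaves a piece of probability at most [2^-n], since [pr A] is at most 1. *)
Lemma atomless_small A e : measurable A -> 0 < pr A -> 0 < e ->
  exists B, [/\ measurable B, B `<=` A, 0 < pr B & pr B <= e].
Proof.
move=> mA A0 e0.
have H n : exists B, [/\ measurable B, B `<=` A, 0 < pr B & pr B <= 2^-1 ^+ n].
  elim: n => [|n [B [mB BA B0 Bn]]].
    by exists A; split => //; rewrite expr0 pr_le1.
  have [C [mC CB C0 Ch]] := atomless_half mB B0.
  exists C; split => //; first exact: subset_trans CB BA.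
  by rewrite exprS (le_trans Ch)// mulrC ler_pM2l// invr_gt0.
have : (2^-1 : R) ^+ n @[n --> \oo] --> (0 : R).
  by apply: cvg_expr; rewrite ger0_norm ?invr_ge0// invf_lt1// ltr1n.
move=> /cvgrPdist_le/(_ e e0)[n _ /(_ n (leqnn n))].
rewrite /= sub0r normrN ger0_norm ?exprn_ge0 ?invr_ge0// => hn.
have [B [mB BA B0 Bn]] := H n.
by exists B; split => //; exact: le_trans Bn hn.
Qed.

(* A chain C_n is grown greedily: C_(n+1) takes at least half of the largest
   possible increase, so no further increase is possible for the union. *)
Lemma atomless_subset A t : measurable A -> 0 <= t -> t <= pr A ->
  exists B, [/\ measurable B, B `<=` A & pr B = t].
Proof.
move=> mA t0 tA.
pose ok C := [/\ measurable C, C `<=` A & pr C <= t].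
pose step C D := [/\ ok D, C `<=` D & forall E, ok E -> C `<=` E ->
   pr E - pr C <= 2 * (pr D - pr C)].
have stepP C : ok C -> exists D, step C D.
  move=> okC; pose S := [set pr E - pr C | E in [set E | ok E /\ C `<=` E]].
  have S0 : S 0 by exists C; [split|rewrite subrr].
  have hS : has_sup S.
    split; first by exists 0.
    exists t => _ [E [[_ _ Et] _] <-].
    by rewrite lerBlDr (le_trans Et)// lerDl pr_ge0.
  (* If no gain is possible, [C] itself is the next set. Otherwise a set whose gain exceeds half of
     the supremum is taken, hence the factor 2 in [step]. *)
  have [s0|s0] := leP (sup S) 0.
    exists C; split => // E okE CE; rewrite subrr mulr0.
    by apply: le_trans s0; apply: ub_le_sup; [exact: hS.2|exists E].
  have [|_ [D [okD CD] <-] hD] := @sup_adherent _ S (sup S / 2) _ hS.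
    by rewrite divr_gt0.
  exists D; split => // E okE CE.
  have : pr E - pr C <= sup S by apply: ub_le_sup; [exact: hS.2|exists E].
  by lra.
have /choice[next nextP] C : exists D, ok C -> step C D.
  by have [/stepP[D]|] := pselect (ok C); [exists D|exists C].
pose F := fix F n := if n is m.+1 then next (F m) else set0.
have okF n : ok (F n).
  elim: n => [|n /nextP[]//]; split => //=.
  by rewrite /pr measure0.
have stF n : step (F n) (F n.+1) by exact: nextP.
have mF n : measurable (F n) by have [] := okF n.
have ndF : nondecreasing_seq F.
  by apply/nondecreasing_seqP => n; apply/subsetPset; have [] := stF n.
pose B := \bigcup_n F n.
have mB : measurable B by exact: bigcup_measurable.
have BA : B `<=` A by move=> x [n _ Fx]; have [_ + _] := okF n; exact.
have cvgF : pr (F n) @[n --> \oo] --> pr B.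
  apply: fine_cvg; rewrite -prE//.
  by apply: nondecreasing_cvg_mu.
have Bt : pr B <= t.
  apply: (cvgr_to_le cvgF).
  by apply: nearW => n; have [] := okF n.
(* If [pr B < t], some non-null [C] in [A \ B] could be added to every [F n]. Each increment would
   then be at least [pr C / 2], although the increments tend to 0. *)
exists B; split => //; apply/eqP; rewrite eq_le Bt leNgt /=; apply/negP => ltBt.
have [|||C [mC CAB C0 Ct]] := @atomless_small (A `\` B) (t - pr B).
- exact: measurableD.
- by rewrite prD// subr_gt0 (lt_le_trans ltBt).
- by rewrite subr_gt0.
have FB n : F n `<=` B by move=> x Fx; exists n.
have disj n : F n `&` C = set0.
  by apply/seteqP; split => // x [Fx /CAB[_]]; apply; exact: (FB n).
have inc n : pr C <= 2 * (pr (F n.+1) - pr (F n)).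
  have [_ _ /(_ (F n `|` C))] := stF n.
  rewrite prU// (addrC (pr (F n))) addrK; apply; last first.
    by move=> x Fx; left.
  split; first exact: measurableU.
    by move=> x [/FB/BA//|/CAB[]].
  have := le_pr (mF n) mB (@FB n); rewrite prU//; lra.
have : 2 * (pr (F n.+1) - pr (F n)) @[n --> \oo] --> 2 * (pr B - pr B).
  apply: cvgMr; apply: cvgB => //.
  by rewrite (cvg_shiftS (fun n => pr (F n))).
rewrite subrr mulr0 => /cvgr_to_ge hl.
have : pr C <= 0 by apply: hl; exact: nearW.
by rewrite leNgt C0.
Qed.

End real_valued_probability.

(** * Quantiles *)

Section value_at_risk.
Context {d : measure_display} {T : measurableType d} {R : realType}.
Variable P : probability T R.
Implicit Types X : {RV P >-> R}.

Lemma cdf_pr X : cdf X = (fun x => (pr P [set w | X w <= x])%:E).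
Proof.
apply/funext => x.
have -> : [set w | X w <= x] = X @^-1` `]-oo, x].
  by apply/seteqP; split => w /=; rewrite in_itv.
by rewrite -prE//; exact: measurable_funPTI.
Qed.

Lemma measurable_le X x : measurable [set w | X w <= x].
Proof.
have -> : [set w | X w <= x] = X @^-1` `]-oo, x].
  by apply/seteqP; split => w /=; rewrite in_itv.
exact: measurable_funPTI.
Qed.

Lemma measurable_gt X x : measurable [set w | x < X w].
Proof.
have -> : [set w | x < X w] = X @^-1` `]x, +oo[.
  by apply/seteqP; split => w /=; rewrite in_itv/= andbT.
exact: measurable_funPTI.
Qed.

Lemma le_pr_cdf X x y : x <= y ->
  pr P [set w | X w <= x] <= pr P [set w | X w <= y].
Proof.
move=> xy; apply: le_pr; [exact: measurable_le..|].
by move=> w /= /le_trans; apply.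
Qed.

(** The Galois connection between quantile and distribution function. The limits of the cdf at the
    two infinities make the infimum meaningful, and right continuity makes it attained. *)
Lemma VaR_le X (s x : R) : 0 < s -> s < 1 ->
  (VaR P s X <= x) = (s <= pr P [set w | X w <= x]).
Proof.
move=> s0 s1.
pose S := [set x : R | s%:E <= P [set w | (X w <= x)%R]]%E.
have SE y : S y = (s <= pr P [set w | X w <= y]) :> Prop.
  by rewrite /S/= prE; [|exact: measurable_le].
have Snonempty : S !=set0.
  have := cvg_cdfy1 X; rewrite cdf_pr.
  move=> /fine_cvg/cvgr_ge/(_ _ s1).
  move=> [M [_ HM]]; exists (M + 1); rewrite SE.
  by apply: HM; rewrite ltrDl.
have Slb : has_lbound S.
  have := cvg_cdfNy0 X; rewrite cdf_pr.
  move=> /fine_cvg/cvgr_lt/(_ _ s0).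
  move=> [M [_ HM]]; exists (M - 1) => y; rewrite SE => sy.
  rewrite leNgt; apply/negP => yM.
  suff : pr P [set w | X w <= y] < s by rewrite ltNge sy.
  by apply: HM; rewrite (lt_trans yM)// ltrBlDr ltrDl.
apply/idP/idP => [Vx|sx]; last by apply: ge_inf => //; rewrite -/S SE.
have Sgt y : x < y -> S y.
  move=> xy; have : inf S < y by exact: le_lt_trans Vx xy.
  move=> /inf_lt -/(_ Snonempty)[z Sz zy].
  by move: Sz; rewrite !SE => /le_trans; apply; apply: le_pr_cdf; exact: ltW.
have := @cdf_right_continuous _ _ _ P X x.
rewrite cdf_pr => /fine_cvg /cvgr_to_ge; apply.
near=> y; have := Sgt y; rewrite SE; apply.
by near: y; exact: nbhs_right_gt.
Unshelve. all: by end_near. Qed.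

Lemma VaR_gt X (s x : R) : 0 < s -> s < 1 ->
  (x < VaR P s X) = (pr P [set w | X w <= x] < s).
Proof. by move=> s0 s1; rewrite !ltNge VaR_le. Qed.

Lemma pr_gt X x : pr P [set w | x < X w] = 1 - pr P [set w | X w <= x].
Proof.
rewrite -prC; last exact: measurable_le.
by congr (pr P _); apply/seteqP; split => w /=; rewrite ltNge => /negP.
Qed.

(** [X < V] is the increasing union of the events [X <= V - 1/(n+1)], each of probability below [s]
    by [VaR_gt]. *)
Lemma pr_ge_VaR X (s : R) : 0 < s -> s < 1 ->
  1 - s <= pr P [set w | VaR P s X <= X w].
Proof.
move=> s0 s1; set V := VaR P s X.
pose F n := [set w | X w <= V - n.+1%:R^-1].
have UF : \bigcup_n F n = ~` [set w | V <= X w].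
  apply/seteqP; split => w /=.
    move=> [n _ Fw]; apply/negP; rewrite -ltNge (le_lt_trans Fw)//.
    by rewrite ltrBlDr ltrDl invr_gt0.
  move=> /negP; rewrite -ltNge => /ltr_add_invr[n Hn].
  by exists n => //=; rewrite /F/= lerBrDr ltW.
have mF n : measurable (F n) by exact: measurable_le.
have mU : measurable (\bigcup_n F n) by exact: bigcup_measurable.
have : pr P (F n) @[n --> \oo] --> pr P (\bigcup_n F n).
  apply: fine_cvg; rewrite -prE//; apply: nondecreasing_cvg_mu => //.
  move=> m n mn; apply/subsetPset => w; rewrite /F /= => /le_trans; apply.
  by rewrite lerD2l lerN2 lef_pV2 ?posrE// ler_nat.
move=> /cvgr_to_le h.
have {}h : pr P (\bigcup_n F n) <= s.
  apply: h; apply: nearW => n; apply: ltW; rewrite -VaR_gt//.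
  by rewrite ltrBlDr ltrDl.
rewrite -[X in 1 - s <= pr P X]setCK prC -?UF//.
by rewrite lerD2l lerN2.
Qed.

Lemma le_VaR X (s t : R) : 0 < s -> s <= t -> t < 1 -> VaR P s X <= VaR P t X.
Proof.
move=> s0 st t1; rewrite VaR_le ?(le_lt_trans st)// (le_trans st)//.
by rewrite -VaR_le// (lt_le_trans s0).
Qed.

Lemma measurable_VaR X : measurable_fun (`]0, 1[ : set R) (fun s => VaR P s X).
Proof.
apply: (measurability (@RGenOInfty.G R)) => [|/= _ [_] [r ->] <-].
  exact: RGenOInfty.measurableE.
have -> : (`]0, 1[ : set R) `&` (fun s => VaR P s X) @^-1` `]r, +oo[ =
          `]0, 1[ `&` `]pr P [set w | X w <= r], +oo[ :> set R.
  apply/seteqP; split => s /=; rewrite !in_itv/= !andbT => -[/andP[s0 s1]];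
  by rewrite ?VaR_gt// -?VaR_gt// s0 s1.
exact: measurableI.
Qed.

Local Notation mu := lebesgue_measure.

(* Layer cake: the excess of the quantile function over c = VaR_p exceeds r
   exactly on ]F (c + r), 1[, which has measure P (X > c + r). *)
Lemma integral_VaR_excess X (p : R) : 0 < p -> p < 1 ->
  (\int[mu]_(s in `]p, 1%R[) (VaR P s X - VaR P p X)%:E =
   'E_P[((X \- cst (VaR P p X))^\+)%R])%E.
Proof.
move=> p0 p1; set c := VaR P p X.
pose Z s : R := if (p < s) && (s < 1) then VaR P s X - c else 0.
have Z0 s : 0 <= Z s.
  rewrite /Z; case: ifPn => // /andP[ps s1].
  by rewrite subr_ge0 le_VaR// ltW.
have pF r : 0 <= r -> p <= pr P [set w | X w <= c + r].
  by move=> r0; rewrite -VaR_le// lerDl.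
have Zr r : 0 <= r ->
    [set s | r < Z s] = `]pr P [set w | X w <= c + r], 1[%classic.
  move=> r0; apply/seteqP; split => s /=; rewrite in_itv/= /Z.
    case: ifPn => [/andP[ps s1]|_]; last by rewrite ltNge r0.
    by rewrite ltrBrDl VaR_gt ?(lt_trans p0)// s1 andbT.
  move=> /andP[Fs s1]; have ps : p < s by exact: le_lt_trans (pF _ r0) Fs.
  by rewrite ps s1/= ltrBrDl VaR_gt// (lt_trans p0).
have mZ : measurable_fun setT Z.
  apply: (measurability (@RGenOInfty.G R)) => [|/= _ [_] [r ->] <-].
    exact: RGenOInfty.measurableE.
  rewrite setTI; have [r0|r0] := leP 0 r.
    have -> : Z @^-1` `]r, +oo[ = [set s | r < Z s].
      by apply/seteqP; split => s /=; rewrite in_itv/= andbT.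
    by rewrite Zr.
  rewrite (_ : _ @^-1` _ = setT)//.
  by apply/seteqP; split => s //= _; rewrite in_itv/= andbT (lt_le_trans r0).
(* Under the uniform law on [0, 1], [Z] becomes a nonnegative random variable, so the two integrals
   are expectations and can be compared through their tail functions. *)
pose U := uniform_prob (@ltr01 R).
pose ZU : {RV U >-> R} :=
  @mfun_Sub _ _ (measurableTypeR R) R Z (mem_set mZ).
have mXc : measurable_fun setT (X \- cst c)^\+.
  by apply: measurable_funrpos; exact: measurable_funB.
pose Y : {RV P >-> R} := mfun_Sub (mem_set mXc).
have EE : ('E_U[ZU] = 'E_P[Y])%E.
  have Y0 w : 0 <= Y w by exact: funrpos_ge0.
  rewrite !ge0_expectation_ccdf//.
  apply: eq_integral => r; rewrite inE/= in_itv/= andbT => r0.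
  transitivity (pr P [set w | c + r < X w])%:E; last first.
    rewrite -prE; last exact: measurable_gt.
    rewrite /ccdf /distribution /pushforward; congr (P _).
    apply/seteqP; split => w /=; rewrite in_itv/= andbT /funrpos/=.
      by rewrite -ltrBrDl => h; rewrite lt_max h.
    by rewrite lt_max ltrBrDl => /orP[//|]; rewrite ltNge r0.
  rewrite pr_gt /ccdf /distribution /pushforward.
  have -> : ZU @^-1` `]r, +oo[ = `]pr P [set w | X w <= c + r], 1[%classic.
    by rewrite -Zr//; apply/seteqP; split => s /=; rewrite in_itv/= andbT.
  rewrite /U /uniform_prob integral_uniform_pdf setIidl; last first.
    apply: subset_itv => //; rewrite bnd_simp// (le_trans _ (pF _ r0))//.
    exact: ltW.
  rewrite (eq_integral (cst 1%E)); last first.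
    move=> s; rewrite inE/= in_itv/= => /andP[Fs s1].
    rewrite /uniform_pdf subr0 invr1 (ltW s1).
    by rewrite (le_trans (pr_ge0 _ _) (ltW Fs)).
  rewrite integral_cst//= lebesgue_measure_itv/= mul1e lte_fin.
  (* When the distribution function equals 1 at [c + r] the interval is empty and both sides
     vanish. *)
  have := pr_le1 P (measurable_le X (c + r)).
  rewrite le_eqVlt => /predU1P[->|->]; last by rewrite -EFinB.
  by rewrite ltxx subrr.
rewrite -[RHS]EE unlock integral_uniform//=; last first.
  exact/measurable_EFinP.
rewrite subr0 invr1 mul1e.
rewrite integral_mkcond [RHS]integral_mkcond; apply: eq_integral => s _.
rewrite !patchE !mem_setE !in_itv/= /Z.
case: ifPn => [/andP[ps s1]|]; last by case: ifPn.
by rewrite (ltW (lt_trans p0 ps)) (ltW s1).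
Qed.

End value_at_risk.

(** * Expected shortfall *)

Section expected_shortfall.
Context {d : measure_display} {T : measurableType d} {R : realType}.
Variable P : probability T R.
Variable p : R.
Hypotheses (p0 : 0 < p) (p1 : p < 1).
Implicit Types X : {RV P >-> R}.

Let onep0 : 0 < 1 - p. Proof. by rewrite subr_gt0. Qed.

Lemma integrable_sub_cst X (c : R) : P.-integrable setT (EFin \o X) ->
  P.-integrable setT (EFin \o (X \- cst c)).
Proof.
move=> iX; rewrite (_ : _ \o _ = (EFin \o X) \- (EFin \o cst c))%E//.
by apply: integrableB => //; exact: finite_measure_integrable_cst.
Qed.

Lemma integrable_excess X (c : R) : P.-integrable setT (EFin \o X) ->
  P.-integrable setT (EFin \o (X \- cst c)^\+).
Proof.
by move=> iX; apply: integrable_funrpos => //; exact: integrable_sub_cst.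
Qed.

(** The Rockafellar-Uryasev formula: split the quantile into [VaR_p] and its excess, and transfer
    the excess to the probability space by [integral_VaR_excess]. *)
Lemma ES_excess X : P.-integrable setT (EFin \o X) ->
  (1 - p) * ES P p X =
  (1 - p) * VaR P p X + \int[P]_w (X \- cst (VaR P p X))^\+ w.
Proof.
move=> iX; set c := VaR P p X.
rewrite /ES mulrA mulfV ?gt_eqF// mul1r.
have mp : lebesgue_measure `]p, 1[ = (1 - p)%:E.
  by rewrite lebesgue_measure_itv/= lte_fin p1.
have iE : (\int[lebesgue_measure]_(s in `]p, 1%R[) (VaR P s X - c)%:E =
  (\int[P]_w (X \- cst c)^\+ w)%:E)%E.
  rewrite integral_VaR_excess// unlock /Rintegral fineK//.
  by apply: integrable_fin_num => //; exact: integrable_excess.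
have mV : measurable_fun `]p, 1[ (fun s => VaR P s X).
  apply: measurable_funS (measurable_VaR X) => //.
  by apply: subset_itv; rewrite bnd_simp// ltW.
(* The excess is nonnegative on []p, 1[], so its integrability is the finiteness of the integral
   already computed in [iE]. *)
have iV : lebesgue_measure.-integrable `]p, 1[
    (EFin \o (fun s => VaR P s X - c)).
  apply/integrableP; split.
    by apply/measurable_EFinP; exact: measurable_funB.
  rewrite [ltLHS](_ : _ = (\int[P]_w (X \- cst c)^\+ w)%:E) ?ltry// -iE.
  apply: eq_integral => s; rewrite inE/= in_itv/= => /andP[ps s1].
  by rewrite ger0_norm// subr_ge0 le_VaR// ltW.
have ic : lebesgue_measure.-integrable `]p, 1[ (EFin \o cst c).
  apply/integrableP; split; first exact/measurable_EFinP.
  rewrite [ltLHS](_ : _ = (`|c| * (1 - p))%:E) ?ltry//.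
  by rewrite EFinM -mp -integral_cst.
transitivity (\int[lebesgue_measure]_(s in `]p, 1[) ((VaR P s X - c) + cst c s)).
  by apply: eq_Rintegral => s _; rewrite subrK.
rewrite RintegralD// /Rintegral iE/= integral_cst// [X in (_ * X)%E]mp/=.
by rewrite addrC mulrC.
Qed.

Lemma tail_integral_decomp X (B : set T) (c : R) :
  P.-integrable setT (EFin \o X) -> measurable B -> pr P B = 1 - p ->
  \int[P]_(w in B) X w = (1 - p) * c + \int[P]_(w in B) (X \- cst c) w.
Proof.
move=> iX mB PB.
transitivity (\int[P]_(w in B) ((X \- cst c) w + cst c w)).
  by apply: eq_Rintegral => w _; rewrite /= subrK.
rewrite RintegralD//; last 2 first.
- by apply: integrableS (integrable_sub_cst _ iX).
- by apply: finite_measure_integrable_cst.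
by rewrite [X in _ + X]Rintegral_cst// -[fine _]/(pr P B) PB addrC mulrC.
Qed.

(** On [B] the difference [X - c] is at most its positive part, and extending the integral of the
    latter to the whole space can only increase it. *)
Lemma le_tail_integral_ES X (B : set T) : P.-integrable setT (EFin \o X) ->
  measurable B -> pr P B = 1 - p ->
  \int[P]_(w in B) X w <= (1 - p) * ES P p X.
Proof.
move=> iX mB PB; set c := VaR P p X.
rewrite ES_excess// (tail_integral_decomp c)// lerD2l.
have iE := integrable_excess c iX; have iD := integrable_sub_cst c iX.
apply: (@le_trans _ _ (\int[P]_(w in B) (X \- cst c)^\+ w)).
  apply: le_Rintegral => //; [exact: integrableS iD|exact: integrableS iE|].
  by move=> w _; rewrite /funrpos le_max lexx.
rewrite -[in leRHS](setUv B) Rintegral_setU ?setUv//.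
- by rewrite lerDl Rintegral_ge0// => w _; exact: funrpos_ge0.
- exact: measurableC.
- exact/disj_setPCl.
Qed.

(** The equality case of the previous bound: [X - c] is its own positive part on [A], and that
    positive part vanishes off [A]. *)
Lemma tail_integral_ES_ae X (A : set T) : P.-integrable setT (EFin \o X) ->
  measurable A -> pr P A = 1 - p ->
  {ae P, forall w, A w -> VaR P p X <= X w} ->
  {ae P, forall w, ~ A w -> X w <= VaR P p X} ->
  \int[P]_(w in A) X w = (1 - p) * ES P p X.
Proof.
move=> iX mA PA h1 h2; set c := VaR P p X.
rewrite ES_excess// (tail_integral_decomp c)//; congr (_ + _).
have iE := integrable_excess c iX; have iD := integrable_sub_cst c iX.
rewrite -[in RHS](setUv A) Rintegral_setU ?setUv//; last 2 first.
- exact: measurableC.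
- exact/disj_setPCl.
rewrite [X in _ = _ + X](_ : _ = 0) ?addr0.
  rewrite /Rintegral; congr fine; apply: ae_eq_integral => //.
  - exact: measurable_int (integrableS _ _ _ iD).
  - exact: measurable_int (integrableS _ _ _ iE).
  apply: filterS h1 => w + Aw => /(_ Aw) cX.
  by rewrite /funrpos/= max_l// subr_ge0.
rewrite /Rintegral.
rewrite (_ : (\int[P]_(w in ~` A) _)%E = (\int[P]_(w in ~` A) cst 0 w)%E).
  by rewrite integral0.
apply: ae_eq_integral => //.
- exact: measurableC.
- by apply: measurable_int (integrableS _ _ _ iE) => //; exact: measurableC.
apply: filterS h2 => w + Aw => /(_ Aw) cX.
by rewrite /funrpos/= max_r// subr_le0.
Qed.

Lemma ae_exists (B : set T) (Q : T -> Prop) : measurable B -> 0 < pr P B ->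
  {ae P, forall w, Q w} -> exists w, B w /\ Q w.
Proof.
move=> mB B0 [N [mN N0 QN]].
apply: contrapT => h; have BN : B `<=` N.
  by move=> w Bw; apply: QN => /= Qw; apply: h; exists w.
have := le_pr P mB mN BN; rewrite {2}/pr N0/= leNgt.
by move=> /negP; apply.
Qed.

Lemma pr0_ae (B : set T) : measurable B -> pr P B = 0 -> {ae P, forall w, ~ B w}.
Proof.
move=> mB B0; exists B; split => //; first by rewrite prE// B0.
by move=> w /= /contrapT.
Qed.

(** Links the abstract tail condition to the quantile: up to null sets, [VaR_p] separates the values
    on [A] from those on its complement, which is what [tail_integral_ES_ae] needs. *)
Lemma p_tail_event_VaR X (A : set T) : p_tail_event P p X A ->
  [/\ measurable A, pr P A = 1 - p,
    {ae P, forall w, A w -> VaR P p X <= X w} &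
    {ae P, forall w, ~ A w -> X w <= VaR P p X}].
Proof.
set c := VaR P p X; move=> [[mA _ _ H] PA].
have {}PA : pr P A = 1 - p by rewrite /pr PA.
have mlt : measurable (A `&` [set w | X w < c]).
  apply: measurableI => //; rewrite (_ : [set _ | _] = X @^-1` `]-oo, c[).
    exact: measurable_funPTI.
  by apply/seteqP; split => w /=; rewrite in_itv.
have mle : measurable (A `&` [set w | X w <= c]).
  by apply: measurableI => //; exact: measurable_le.
have mCA : measurable (~` A) by exact: measurableC.
have PCA : pr P (~` A) = p by rewrite prC// PA subKr.
split => //.
  have := pr_ge0 P (A `&` [set w | X w < c]).
  rewrite le_eqVlt => /predU1P[/esym/(pr0_ae mlt)|].
    by apply: filterS => w /= h Aw; rewrite leNgt; apply/negP => Xc; exact: h.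
  (* A typical [w] in [A] with [X w < c] dominates [X] almost everywhere off [A]; then [X <= X w]
     has probability at least [p], contradicting [X w < VaR_p]. *)
  move=> /(ae_exists mlt)/(_ H)[w [[Aw /= Xwc] hw]].
  exfalso; move: Xwc; rewrite VaR_gt// ltNge => /negP; apply.
  have [N [mN N0 hN]] := hw.
  rewrite -PCA; have mX := measurable_le X (X w).
  apply: (@le_trans _ _ (pr P ([set v | X v <= X w] `|` N))).
    apply: le_pr => //; first exact: measurableU.
    move=> v nAv; have [|Xvw] := leP (X v) (X w); first by left.
    right; apply: hN => /= /(_ Aw nAv); rewrite leNgt Xvw//.
  by apply: (le_trans (le_prU P mX mN)); rewrite [pr P N]/pr N0 addr0.
have := pr_ge0 P (A `&` [set w | X w <= c]).
(* If [X <= c] is null inside [A], it has probability at least [p] inside the complement, hence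
   fills it up to a null set. Otherwise a typical [w] of [A] with [X w <= c] bounds [X] off [A]. *)
rewrite le_eqVlt => /predU1P[/esym h0|].
  have mX := measurable_le X c.
  have mB : measurable (~` A `\` [set w | X w <= c]) by exact: measurableD.
  have : {ae P, forall w, ~ (~` A `\` [set w | X w <= c]) w}.
    apply: (pr0_ae mB); apply/eqP; rewrite eq_le pr_ge0 andbT.
    have : p <= pr P [set w | X w <= c] by rewrite -VaR_le.
    rewrite (prID P mX mA) setIC h0 add0r setDE setIC => pX.
    by have := prID P mCA mX; rewrite PCA; lra.
  by apply: filterS => w /= h nA; apply: contrapT => Xc; apply: h; split.
move=> /(ae_exists mle)/(_ H)[w [[Aw /= Xwc] hw]].
by apply: filterS hw => v + nAv => /(_ Aw nAv) /le_trans; apply.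
Qed.

End expected_shortfall.

(** * Expected shortfall as a maximum of tail integrals on [L^q] *)

Section expected_shortfall_Lq.
Context {d : measure_display} {T : measurableType d} {R : realType}.
Variable P : probability T R.
Hypothesis hP : atomless P.
Variable p : R.
Hypotheses (p0 : 0 < p) (p1 : p < 1).
Variables (q : R) (hq : (1 <= q%:E)%E).
Implicit Types X Y : LfunType P hq.

Let onep0 : 0 < 1 - p. Proof. by rewrite subr_gt0. Qed.

Lemma Lq_integrable X : P.-integrable setT (EFin \o X).
Proof.
apply/Lfun1_integrable; apply: (Lfun_subset _ hq) => //.
- by rewrite fin_num_measure.
- exact: LfunP.
Qed.

Lemma expectation_Rintegral X : fine 'E_P[X] = \int[P]_w X w.
Proof. by rewrite unlock. Qed.

(** [1 - p] lies between the probabilities of [X > c] and [X >= c]; atomlessness supplies the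
    missing mass from the level set [X = c]. *)
Lemma exists_VaR_tail (X : {RV P >-> R}) : exists A,
  [/\ measurable A, pr P A = 1 - p, forall w, A w -> VaR P p X <= X w &
    forall w, ~ A w -> X w <= VaR P p X].
Proof.
set c := VaR P p X.
have mgt := measurable_gt X c.
have mge : measurable [set w | c <= X w].
  rewrite (_ : [set _ | _] = X @^-1` `[c, +oo[); first exact: measurable_funPTI.
  by apply/seteqP; split => w /=; rewrite in_itv/= andbT.
have gt_ge : [set w | c < X w] `<=` [set w | c <= X w] by move=> w /=/ltW.
have gt_le : pr P [set w | c < X w] <= 1 - p.
  by rewrite pr_gt lerD2l lerN2 -VaR_le.
have [|||B [mB BA PB]] := @atomless_subset _ _ _ P hP
    ([set w | c <= X w] `\` [set w | c < X w]) (1 - p - pr P [set w | c < X w]).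
- exact: measurableD.
- by rewrite subr_ge0.
- by rewrite prD// lerD2r pr_ge_VaR.
exists ([set w | c < X w] `|` B); split.
- exact: measurableU.
- rewrite prU//; first by rewrite PB addrC subrK.
  by apply/seteqP; split => // w [h /BA[]].
- by move=> w [/ltW//|/BA[]].
- by move=> w h; rewrite leNgt; apply/negP => Xw; apply: h; left.
Qed.

Lemma exists_tail_integral_ES X : exists A, [/\ measurable A, pr P A = 1 - p &
  \int[P]_(w in A) X w = (1 - p) * ES P p X].
Proof.
have [A [mA PA h1 h2]] := exists_VaR_tail X.
exists A; split => //; apply: tail_integral_ES_ae => //.
- exact: Lq_integrable.
- exact: aeW.
- exact: aeW.
Qed.

Lemma eq_in_law_ES X Y : eq_in_law (P := P) X Y -> ES P p X = ES P p Y.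
Proof.
move=> XY; rewrite /ES; congr (_ * _).
apply: eq_Rintegral => s _; rewrite /VaR; congr inf.
apply/seteqP; split => x /=; have := XY _ (measurable_itv `]-oo, x]);
rewrite /distribution /pushforward;
have eqs (Z : LfunType P hq) : Z @^-1` `]-oo, x] = [set w | Z w <= x]
  by [apply/seteqP; split => w /=; rewrite in_itv];
by rewrite !eqs => ->.
Qed.

Lemma eq_in_law_expectation X Y : eq_in_law (P := P) X Y ->
  fine 'E_P[X] = fine 'E_P[Y].
Proof.
move=> XY; rewrite unlock.
have iE (Z : LfunType P hq) :
    (\int[P]_w (Z w)%:E = \int[distribution P Z]_y y%:E)%E.
  by rewrite integral_distribution//; exact: Lq_integrable.
rewrite !iE; congr fine; apply: eq_measure_integral => A mA _; exact: XY.
Qed.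

Lemma expectation_Lq_add X Y :
  fine 'E_P[X + Y] = fine 'E_P[X] + fine 'E_P[Y].
Proof. by rewrite !expectation_Rintegral RintegralD//; exact: Lq_integrable. Qed.

Lemma expectation_Lq_scale k X : fine 'E_P[k *: X] = k * fine 'E_P[X].
Proof. by rewrite !expectation_Rintegral RintegralZl//; exact: Lq_integrable. Qed.

Lemma Rintegral_Lq_add A X Y : measurable A ->
  \int[P]_(w in A) (X + Y) w = \int[P]_(w in A) X w + \int[P]_(w in A) Y w.
Proof.
by move=> mA; rewrite RintegralD//; apply: integrableS (Lq_integrable _).
Qed.

(** The maximizing event for [X + Y] bounds its ES by the sum of the separate ones. These depend on
    the laws only, and a common tail event attains both maxima at once. *)
Lemma le_ES_concentrated X Y X' Y' : p_concentrated P p X' Y' ->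
  eq_in_law (P := P) X X' -> eq_in_law (P := P) Y Y' ->
  ES P p (X + Y) <= ES P p (X' + Y').
Proof.
move=> [A [tX tY]] eX eY.
have [mA PA X1 X2] := p_tail_event_VaR p0 p1 tX.
have [_ _ Y1 Y2] := p_tail_event_VaR p0 p1 tY.
rewrite -(ler_pM2l onep0).
have [B [mB PB <-]] := exists_tail_integral_ES (X + Y).
rewrite Rintegral_Lq_add//.
apply: (le_trans (lerD
  (le_tail_integral_ES p0 p1 (Lq_integrable X) mB PB)
  (le_tail_integral_ES p0 p1 (Lq_integrable Y) mB PB))).
rewrite (eq_in_law_ES eX) (eq_in_law_ES eY).
rewrite -(tail_integral_ES_ae p0 p1 (Lq_integrable X') mA PA X1 X2).
rewrite -(tail_integral_ES_ae p0 p1 (Lq_integrable Y') mA PA Y1 Y2).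
rewrite -Rintegral_Lq_add//.
by apply: le_tail_integral_ES => //; exact: Lq_integrable.
Qed.

Lemma le_ES X Y : (forall w, X w <= Y w) -> ES P p X <= ES P p Y.
Proof.
move=> XY; rewrite -(ler_pM2l onep0).
have [B [mB PB <-]] := exists_tail_integral_ES X.
apply: (@le_trans _ _ (\int[P]_(w in B) Y w)).
  by apply: le_Rintegral => //; apply: integrableS (Lq_integrable _).
by apply: le_tail_integral_ES => //; exact: Lq_integrable.
Qed.

Lemma le_expectation_Lq X Y : (forall w, X w <= Y w) ->
  fine 'E_P[X] <= fine 'E_P[Y].
Proof.
by move=> XY; rewrite !expectation_Rintegral le_Rintegral//; exact: Lq_integrable.
Qed.

(** Places [(ES, E)] in the half-plane [HH]. The integral over [A] is [(1 - p) ES]; off [A],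
    [X <= c <= ES] contributes at most [p ES]. *)
Lemma expectation_le_ES X : fine 'E_P[X] <= ES P p X.
Proof.
have [A [mA PA h1 h2]] := exists_VaR_tail X.
have iX := Lq_integrable X; set c := VaR P p X.
have iA : \int[P]_(w in A) X w = (1 - p) * ES P p X.
  by apply: tail_integral_ES_ae => //; exact: aeW.
have mCA : measurable (~` A) by exact: measurableC.
have cES : c <= ES P p X.
  rewrite -(ler_pM2l onep0) ES_excess// lerDl.
  by apply: Rintegral_ge0 => w _; exact: funrpos_ge0.
rewrite expectation_Rintegral -(setUv A) Rintegral_setU ?setUv//; last first.
  exact/disj_setPCl.
have : \int[P]_(w in ~` A) X w <= p * c.
  apply: (@le_trans _ _ (\int[P]_(w in ~` A) cst c w)).
    apply: le_Rintegral => //; first exact: integrableS iX.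
    exact: finite_measure_integrable_cst.
  by rewrite Rintegral_cst// -[fine _]/(pr P (~` A)) prC// PA subKr mulrC.
rewrite iA => h; apply: (le_trans (lerD (lexx _) h)).
rewrite -[leRHS]mul1r -[in leRHS](subrK p 1) [leRHS]mulrDl lerD2l.
by rewrite ler_pM2l.
Qed.

End expected_shortfall_Lq.

(** * Bounds and limits in L^q *)

Section Lq_norm.
Context {d : measure_display} {T : measurableType d} {R : realType}.
Variable P : probability T R.
Variables (q : R) (hq : (1 <= q%:E)%E).

Let q0 : 0 < q. Proof. by rewrite (lt_le_trans ltr01)// -lee_fin. Qed.

Lemma Lnorm_le (f : T -> R) (e : R) : 0 <= e ->
  (\int[P]_w (`|f w| `^ q)%:E <= (e `^ q)%:E)%E ->
  ('N[P]_(q%:E)[EFin \o f] <= e%:E)%E.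
Proof.
move=> e0 h; rewrite unlock /=.
have -> : e%:E = ((e `^ q)%:E `^ q^-1)%E.
  by rewrite poweR_EFin -powRrM mulfV ?gt_eqF// powRr1.
apply: gt0_ler_poweR => //; first by rewrite invr_ge0 ltW.
- by rewrite in_itv/= leey andbT integral_ge0.
- by rewrite in_itv/= leey andbT lee_fin powR_ge0.
Qed.

Lemma Lnorm_le_sup (f : T -> R) (e : R) : 0 <= e -> measurable_fun setT f ->
  (forall w, `|f w| <= e) -> ('N[P]_(q%:E)[EFin \o f] <= e%:E)%E.
Proof.
move=> e0 mf fe; apply: Lnorm_le => //.
apply: (@le_trans _ _ (\int[P]_w (cst (e `^ q)%:E w))%E); last first.
  by rewrite integral_cst// [X in (_ * X <= _)%E]probability_setT mule1.
apply: ge0_le_integral => //.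
- apply/measurable_EFinP.
  apply: (@measurableT_comp _ _ _ _ _ _ (@powR R ^~ q)) => //.
  exact: measurableT_comp.
- by move=> w _; rewrite lee_fin ge0_ler_powR ?nnegrE// ltW.
Qed.

Lemma bounded_Lfun (f : T -> R) (e : R) : measurable_fun setT f ->
  (forall w, `|f w| <= e) -> f \in Lfun P q%:E.
Proof.
move=> mf fe; rewrite inE; apply/andP; split; rewrite inE//= /finite_norm.
apply: le_lt_trans (ltry `|e|); apply: Lnorm_le_sup => // w.
exact: le_trans (fe w) (ler_norm _).
Qed.

Lemma dominated_Lfun (f : T -> R) (G : LfunType P hq) : measurable_fun setT f ->
  (forall w, `|f w| <= `|G w|) -> f \in Lfun P q%:E.
Proof.
move=> mf fG; rewrite inE; apply/andP; split; rewrite inE//= /finite_norm.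
have := Lfunction_finite hq G; rewrite /finite_norm; apply: le_lt_trans.
rewrite unlock /= gt0_ler_poweR ?invr_ge0 ?(ltW q0)//.
- by rewrite in_itv/= leey andbT integral_ge0.
- by rewrite in_itv/= leey andbT integral_ge0.
- apply: ge0_le_integral => //.
  + apply/measurable_EFinP.
    apply: (@measurableT_comp _ _ _ _ _ _ (@powR R ^~ q)) => //.
    exact: measurableT_comp.
  + apply/measurable_EFinP.
    apply: (@measurableT_comp _ _ _ _ _ _ (@powR R ^~ q)) => //.
    exact: measurableT_comp.
  + by move=> w _; rewrite lee_fin ge0_ler_powR ?nnegrE// ltW.
Qed.

Lemma indic_Lfun (B : set T) : measurable B -> (\1_B : T -> R) \in Lfun P q%:E.
Proof.
move=> mB; apply: (@bounded_Lfun _ 1); first exact: measurable_indic.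
by move=> w; rewrite indicE normr_nat lern1; case: (_ \in _).
Qed.

(* Total in B, with value 0 on non-measurable sets. *)
Definition ind (B : set T) : LfunType P hq :=
  if pselect (measurable B) is left mB then Lfun_Sub hq (indic_Lfun mB) else 0.

Lemma indE (B : set T) w : measurable B -> ind B w = (w \in B)%:R.
Proof. by move=> mB; rewrite /ind; case: pselect. Qed.

Lemma ind_in (B : set T) w : measurable B -> B w -> ind B w = 1.
Proof. by move=> mB Bw; rewrite indE// mem_set. Qed.

Lemma ind_out (B : set T) w : measurable B -> ~ B w -> ind B w = 0.
Proof. by move=> mB Bw; rewrite indE// memNset. Qed.

Lemma expectation_ind (B : set T) : measurable B -> fine 'E_P[ind B] = pr P B.
Proof.
move=> mB; rewrite /pr -expectation_indic//.
by congr (fine 'E_P[_]); apply/funext => w; rewrite indE.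
Qed.

Lemma expectation_cvg (u : nat -> LfunType P hq) (X G : LfunType P hq) :
  (forall w, u n w @[n --> \oo] --> X w) -> (forall n w, `|u n w| <= G w) ->
  fine 'E_P[u n] @[n --> \oo] --> fine 'E_P[X].
Proof.
move=> uX uG; rewrite unlock.
have iX := Lq_integrable X.
apply: fine_cvg; rewrite fineK; last exact: integrable_fin_num.
have [|||||_ _] // := @dominated_convergence _ T R P setT measurableT
  (fun n => EFin \o u n) (EFin \o X) (EFin \o G).
- by move=> n; apply/measurable_EFinP.
- by apply/measurable_EFinP.
- by apply: aeW => w _; apply: cvg_EFin; [exact: nearW|exact: uX].
- exact: Lq_integrable.
- by apply: aeW => w n _; rewrite lee_fin.
Qed.

Variables (rho : LfunType P hq -> R) (hrho : Lq_continuous rho).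

Lemma rho_sup_continuous (X : LfunType P hq) (e : R) : 0 < e ->
  exists2 delta : R, 0 < delta & forall Y : LfunType P hq,
    (forall w, `|Y w - X w| <= delta) -> `|rho Y - rho X| < e.
Proof.
move=> e0; have [delta dp h] := hrho X e0.
exists (delta / 2); first by rewrite divr_gt0.
move=> Y XY; apply: h; apply: (@le_lt_trans _ _ (delta / 2)%:E).
  by apply: Lnorm_le_sup => //; rewrite divr_ge0// ltW.
by rewrite lte_fin ltr_pdivrMr// ltr_pMr// ltr1n.
Qed.

(** Dominated convergence applied to [|u n - X|^q], with bound [|G|^q], gives convergence in norm,
    to which continuity of [rho] applies. *)
Lemma rho_cvg (u : nat -> LfunType P hq) (X G : LfunType P hq) :
  (forall w, u n w @[n --> \oo] --> X w) ->
  (forall n w, `|u n w - X w| <= G w) ->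
  rho (u n) @[n --> \oo] --> rho X.
Proof.
move=> uX uG; apply/cvgrPdist_lt => e e0.
have [delta dp h] := hrho X e0.
have dq : 0 < (delta / 2) `^ q by rewrite powR_gt0// divr_gt0.
have mD n : measurable_fun setT (fun w => (`|u n w - X w| `^ q)%:E).
  apply/measurable_EFinP.
  apply: (@measurableT_comp _ _ _ _ _ _ (@powR R ^~ q)) => //.
  by apply: measurableT_comp => //; exact: (measurable_funP (u n - X)).
have : (\int[P]_w (`|u n w - X w| `^ q)%:E @[n --> \oo] --> \int[P]_w 0%:E)%E.
  have [|||||_ _] // := @dominated_convergence _ T R P setT measurableT
    (fun n w => (`|u n w - X w| `^ q)%:E) (cst 0%:E) (fun w => (`|G w| `^ q)%:E).
  - apply: aeW => w _; apply: cvg_EFin; first exact: nearW.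
    apply/cvgrPdist_le => e' e'0.
    have e'q : 0 < e' `^ q^-1 by rewrite powR_gt0.
    have /cvgrPdist_le/(_ _ e'q) := uX w; apply: filterS => n hn.
    rewrite /= sub0r normrN (ger0_norm (powR_ge0 _ _)).
    rewrite distrC in hn.
    have -> : e' = (e' `^ q^-1) `^ q.
      by rewrite -powRrM mulVf ?gt_eqF// powRr1// ltW.
    by rewrite ge0_ler_powR ?nnegrE ?powR_ge0 ?(ltW q0).
  - apply: Lfun_integrable; [by rewrite -lee_fin|exact: LfunP].
  - apply: aeW => w n _; rewrite gee0_abs ?lee_fin ?powR_ge0//.
    rewrite ge0_ler_powR ?nnegrE ?(ltW q0)//.
    exact: le_trans (uG n w) (ler_norm _).
rewrite integral0 => /fine_cvgP[fin /cvgr_lt/(_ _ dq) lt].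
near=> n; rewrite distrC; apply: h.
apply: (@le_lt_trans _ _ (delta / 2)%:E); last first.
  by rewrite lte_fin ltr_pdivrMr// ltr_pMr// ltr1n.
apply: Lnorm_le; first by rewrite divr_ge0// ltW.
rewrite -[leLHS]fineK; last by near: n.
by rewrite lee_fin ltW//; near: n.
Unshelve. all: by end_near. Qed.

End Lq_norm.

(** * Swapping and averaging *)

Lemma cvg_dist_harmonic (R : realType) (v : nat -> R) (x C : R) :
  (forall n, `|v n - x| <= C / n.+1%:R) -> v n @[n --> \oo] --> x.
Proof.
move=> h; apply/subr_cvg0; apply/norm_cvg0P.
apply: (@squeeze_cvgr _ _ _ _ (fun=> 0) (fun n => C / n.+1%:R)).
- by apply: nearW => n; rewrite normr_ge0 h.
- exact: cvg_cst.
- by rewrite -[X in _ --> X](mulr0 C); apply: cvgMr; exact: cvg_harmonic.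
Qed.

Section averaging.
Context {d : measure_display} {T : measurableType d} {R : realType}.
Variable P : probability T R.
Hypothesis hP : atomless P.
Variable p : R.
Hypotheses (p0 : 0 < p) (p1 : p < 1).
Variables (q : R) (hq : (1 <= q%:E)%E).
Local Notation L := (LfunType P hq).
Local Notation "1[ B ]" := (ind P hq B) (at level 0, format "1[ B ]").
Variables (rho : L -> R) (hrho : Lq_continuous rho) (hCA : p_CA rho p).
Implicit Types (X Y h : L) (B D : set T).

Lemma LqD X Y w : (X + Y) w = X w + Y w. Proof. by []. Qed.
Lemma LqZ k X w : (k *: X) w = k * X w. Proof. by []. Qed.
Lemma LqN X w : (- X) w = - X w. Proof. by []. Qed.
Lemma Lq0 w : (0 : L) w = 0. Proof. by []. Qed.
Definition LqE := (LqD, LqZ, LqN, Lq0).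

Lemma ind_set0 : 1[set0] = 0.
Proof. by apply/LfuneqP => w; rewrite ind_out. Qed.

Lemma indU B D : measurable B -> measurable D -> B `&` D = set0 ->
  1[B `|` D] = 1[B] + 1[D].
Proof.
move=> mB mD BD; apply/LfuneqP => w; have mBD := measurableU _ _ mB mD.
rewrite LqD !indE// in_setU.
case: (boolP (w \in B)) => wB; case: (boolP (w \in D)) => wD //=;
  rewrite ?addr0 ?add0r//.
by move: wB wD; rewrite !inE => wB wD; exfalso; rewrite -[False]/(set0 w) -BD.
Qed.

Lemma eq_in_law_ind k B D : measurable B -> measurable D -> pr P B = pr P D ->
  eq_in_law (P := P) (k *: 1[B]) (k *: 1[D]).
Proof.
move=> mB mD BD S mS.
(* The law of [k 1_E] has mass [pr E] at [k] and the rest at 0, so it depends on [E] through [pr E]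
   only. *)
suff H E : measurable E -> distribution P (k *: 1[E]) S =
    (if pselect (S k) then pr P E else 0)%:E +
    (if pselect (S 0) then 1 - pr P E else 0)%:E.
  by rewrite !H// BD.
move=> mE; rewrite /distribution /pushforward -EFinD.
rewrite -[X in P X = _]/[set w | S (k * 1[E] w)].
case: pselect => Sk; case: pselect => S0.
- rewrite addrC subrK -(probability_setT P); congr (P _).
  apply/seteqP; split => // w _ /=.
  by rewrite indE//; case: (w \in E); rewrite ?mulr1 ?mulr0.
- rewrite addr0 -prE//; congr (P _); apply/seteqP; split => w /=.
    by move=> h; apply: contrapT => nE; move: h; rewrite ind_out// mulr0.
  by move=> Ew; rewrite ind_in// mulr1.
- rewrite add0r -prC// -prE; last exact: measurableC.
  congr (P _); apply/seteqP; split => w /=.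
    by move=> + Ew; rewrite ind_in// mulr1.
  by move=> Ew; rewrite ind_out// mulr0.
- rewrite addr0 (_ : [set w | _] = set0) ?measure0//; apply/seteqP; split => w //=.
  by rewrite indE//; case: (w \in E); rewrite ?mulr1 ?mulr0.
Qed.

(** An everywhere version of the tail condition, stable under sums without any bookkeeping of null
    sets. *)
Definition ptail (A : set T) (X : T -> R) :=
  forall w w', A w -> ~ A w' -> X w' <= X w.

Lemma ptailD A X Y : ptail A X -> ptail A Y -> ptail A (X + Y).
Proof. by move=> hX hY w w' Aw Aw'; rewrite !LqD lerD ?hX ?hY. Qed.

Lemma ptail_cst A k : ptail A (k *: 1[setT]).
Proof. by move=> w w' _ _; rewrite !LqZ !ind_in. Qed.

(** * Swapping along a fixed tail event *)

Section fixed_tail_event.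
Variable A : set T.
Hypotheses (mA : measurable A) (PA : pr P A = 1 - p).

Lemma ptail_event X : ptail A X -> p_tail_event P p X A.
Proof.
move=> h; split; last by rewrite prE// PA.
split => //.
- by rewrite prE// PA lte_fin subr_gt0.
- by rewrite prE// PA lte_fin ltrBlDr ltrDl.
- by apply: aeW => w; apply: aeW => w'; exact: h.
Qed.

Lemma ptail_ind_in k B : measurable B -> B `<=` A -> 0 <= k ->
  ptail A (k *: 1[B]).
Proof.
move=> mB BA k0 w w' Aw Aw'; rewrite !LqZ ler_wpM2l//.
by rewrite (@ind_out _ _ _ P _ hq B w')// ?indE// => /BA.
Qed.

Lemma ptail_ind_out k B : measurable B -> B `<=` ~` A -> 0 <= k ->
  ptail A ((- k) *: 1[B]).
Proof.
move=> mB BA k0 w w' Aw Aw'; rewrite !LqZ !mulNr lerN2 ler_wpM2l//.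
by rewrite (@ind_out _ _ _ P _ hq B w)// ?indE// => /BA.
Qed.

(** Only the target [D] has to be compatible with [A]. This asymmetry later allows mass to be moved
    from outside [A] into it. *)
Lemma rho_swap_le Y k B D : ptail A Y -> ptail A (k *: 1[D]) ->
  measurable B -> measurable D -> pr P B = pr P D ->
  rho (Y + k *: 1[B]) <= rho (Y + k *: 1[D]).
Proof.
move=> tY tD mB mD BD; apply: hCA.
- by exists A; split; exact: ptail_event.
- by [].
- exact: eq_in_law_ind.
Qed.

Lemma rho_swap Y k B D : ptail A Y -> ptail A (k *: 1[B]) -> ptail A (k *: 1[D]) ->
  measurable B -> measurable D -> pr P B = pr P D ->
  rho (Y + k *: 1[B]) = rho (Y + k *: 1[D]).
Proof.
by move=> *; apply/eqP; rewrite eq_le !rho_swap_le.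
Qed.

(** * Averaging over a tail event or its complement *)

Section averaging_over_a_block.
Variables (S : set T) (s : R).
Hypotheses (mS : measurable S) (S0 : 0 < pr P S).
Hypothesis tailS : forall k B, measurable B -> B `<=` S -> 0 <= k ->
  ptail A ((s * k) *: 1[B]).

(* n copies of B are moved around so that they cover S evenly: m times
   everywhere, and once more on D. *)
Lemma rho_spread B n : measurable B -> B `<=` S -> exists (m : nat) D,
  [/\ measurable D, D `<=` S, n%:R * pr P B = m%:R * pr P S + pr P D &
  forall Y k, ptail A Y -> 0 <= k ->
    rho (Y + (s * (k * n%:R)) *: 1[B]) =
    rho (Y + (s * (k * m%:R)) *: 1[S] + (s * k) *: 1[D])].
Proof.
move=> mB BS; elim: n => [|n [m [D [mD DS eD IH]]]].
  exists 0%N, set0; split => //; first by rewrite !mul0r /pr measure0 addr0.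
  move=> Y k tY k0; congr rho; apply/LfuneqP => w.
  by rewrite ind_set0 !LqE; ring.
have mSD : measurable (S `\` D) by exact: measurableD.
(* One slice is absorbed into [Y], the other [n] are spread by induction, and the remaining slice is
   swapped to any [B'] of the same probability. *)
have step B' : measurable B' -> B' `<=` S -> pr P B' = pr P B -> forall Y k,
    ptail A Y -> 0 <= k -> rho (Y + (s * (k * n.+1%:R)) *: 1[B]) =
    rho (Y + (s * (k * m%:R)) *: 1[S] + (s * k) *: 1[D] + (s * k) *: 1[B']).
  move=> mB' B'S eB' Y k tY k0.
  transitivity (rho ((Y + (s * k) *: 1[B]) + (s * (k * n%:R)) *: 1[B])).
    by congr rho; apply/LfuneqP => w; rewrite !LqE -addn1 natrD; ring.
  rewrite IH//; last by apply: ptailD => //; exact: tailS.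
  transitivity
    (rho (Y + (s * (k * m%:R)) *: 1[S] + (s * k) *: 1[D] + (s * k) *: 1[B])).
    by congr rho; apply/LfuneqP => w; rewrite !LqE; ring.
  apply: rho_swap => //; try exact: tailS.
  apply: ptailD; last exact: tailS.
  by apply: ptailD => //; apply: tailS => //; rewrite mulr_ge0.
(* If the new slice fits into [S \ D], it enlarges [D]. Otherwise it completes a layer, so [m] grows
   by one, and the overflow [D'] inside [D] starts the next layer. *)
have [le|lt] := leP (pr P B) (pr P (S `\` D)).
  have [B' [mB' B'SD eB']] := atomless_subset hP mSD (pr_ge0 P B) le.
  have dis : D `&` B' = set0 by apply/seteqP; split => // w [Dw /B'SD[]].
  exists m, (D `|` B'); split.
  - exact: measurableU.
  - by move=> w [/DS//|/B'SD[]].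
  - by rewrite prU// addrA -eD eB' -natr1 mulrDl mul1r.
  - move=> Y k tY k0; rewrite (step B')//; last by move=> w /B'SD[].
    by rewrite indU//; congr rho; apply/LfuneqP => w; rewrite !LqE; ring.
have PSD : pr P (S `\` D) = pr P S - pr P D by exact: prD.
have [||D' [mD' D'D eD']] :=
    @atomless_subset _ _ _ P hP D (pr P B - pr P (S `\` D)) mD.
- by rewrite subr_ge0 ltW.
- by have := le_pr P mB mS BS; rewrite PSD; lra.
have dis : (S `\` D) `&` D' = set0.
  by apply/seteqP; split => // w [[_ Dw] /D'D].
have disD : (S `\` D) `&` D = set0.
  by apply/seteqP; split => // w [[_ Dw]].
have SE : 1[S] = 1[S `\` D] + 1[D].
  by rewrite -indU//; congr (ind P hq _); rewrite setUC setDUK.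
exists m.+1, D'; split => //.
- exact: subset_trans D'D DS.
- by rewrite eD' PSD -(addn1 m) -(addn1 n) !natrD mulrDl eD; ring.
- move=> Y k tY k0; rewrite (step ((S `\` D) `|` D'))//.
  + rewrite indU// SE; congr rho; apply/LfuneqP => w.
    by rewrite !LqE -(addn1 m) natrD; ring.
  + exact: measurableU.
  + by move=> w [[]//|/D'D/DS].
  + by rewrite prU// eD' addrC subrK.
Qed.

(** With slices of height [k / (n+1)], [rho] is constant along the spread variables [u n], which
    converge uniformly to the averaged one. *)
Lemma rho_average_ind B Y k : measurable B -> B `<=` S -> ptail A Y -> 0 <= k ->
  rho (Y + (s * k) *: 1[B]) = rho (Y + (s * (k * (pr P B / pr P S))) *: 1[S]).
Proof.
move=> mB BS tY k0.
have /choice[md mdP] n : exists md : nat * set T,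
    [/\ measurable md.2, md.2 `<=` S,
      n.+1%:R * pr P B = md.1%:R * pr P S + pr P md.2 &
      rho (Y + (s * k) *: 1[B]) =
      rho (Y + (s * (k / n.+1%:R * md.1%:R)) *: 1[S] +
           (s * (k / n.+1%:R)) *: 1[md.2])].
  have [m [D [mD DS eD h]]] := rho_spread n.+1 mB BS.
  exists (m, D); split => //=.
  by rewrite -h ?divr_ge0// divfK.
pose u n := Y + (s * (k / n.+1%:R * (md n).1%:R)) *: 1[S] +
            (s * (k / n.+1%:R)) *: 1[(md n).2].
set X := Y + _ *: 1[S].
(* [u n - X] equals [s k / (n+1)] times [Z], the partial layer minus its own average over [S]; the 2
   bounds [|Z|]. *)
pose C := `|s| * k * 2.
have uX n w : `|u n w - X w| <= C / n.+1%:R.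
  have [mD DS eD _] := mdP n.
  have n0 : 0 < n.+1%:R :> R by [].
  pose Z := 1[(md n).2] w - pr P (md n).2 / pr P S * 1[S] w.
  have Z2 : `|Z| <= 2.
    apply: (le_trans (ler_normB _ _)).
    have : `|1[(md n).2] w| <= 1.
      by rewrite indE//; case: (_ \in _); rewrite ?normr1 ?normr0.
    have : `|pr P (md n).2 / pr P S * 1[S] w| <= 1.
      rewrite indE//; case: (_ \in _); rewrite ?mulr0 ?normr0// mulr1.
      rewrite ger0_norm ?divr_ge0 ?pr_ge0// ler_pdivrMr// mul1r.
      exact: le_pr.
    by lra.
  rewrite (_ : u n w - X w = s * k / n.+1%:R * Z).
    rewrite /C -!mulrA normrM ler_wpM2l// normrM (ger0_norm k0) ler_wpM2l//.
    by rewrite normrM ger0_norm ?invr_ge0// [leRHS]mulrC ler_wpM2l ?invr_ge0.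
  rewrite /Z.
  have -> : pr P (md n).2 = n.+1%:R * pr P B - (md n).1%:R * pr P S.
    by rewrite eD; ring.
  rewrite /u /X !LqE; field.
  by rewrite gt_eqF//= addrC natr1 pnatr_eq0.
have C0 : 0 <= C by rewrite !mulr_ge0.
have : rho (u n) @[n --> \oo] --> rho X.
  apply: (@rho_cvg _ _ _ _ _ _ _ hrho _ _ (C *: 1[setT])).
    by move=> w; apply: cvg_dist_harmonic => n; exact: uX.
  move=> n w; rewrite LqZ ind_in// mulr1 (le_trans (uX n w))//.
  by rewrite ler_pdivrMr// ler_peMr// ler1n.
have -> : (fun n => rho (u n)) = (fun=> rho (Y + (s * k) *: 1[B])).
  by apply/funext => n; have [_ _ _ ->] := mdP n.
by move=> /cvg_lim <-//; rewrite lim_cst.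
Qed.

(** The quantification over [Y] and the first two clauses make the predicate stable under sums:
    while one summand is averaged, the other is part of [Y]. *)
Definition averages h := [/\ forall w, 0 <= h w, ptail A (s *: h) &
  forall Y, ptail A Y ->
    rho (Y + s *: h) = rho (Y + (s * (fine 'E_P[h] / pr P S)) *: 1[S])].

Lemma expectation_Lq_ge0 h : (forall w, 0 <= h w) -> 0 <= fine 'E_P[h].
Proof. by move=> h0; rewrite fine_ge0// expectation_ge0. Qed.

Lemma averages_ind B k : measurable B -> B `<=` S -> 0 <= k ->
  averages (k *: 1[B]).
Proof.
move=> mB BS k0; split.
- by move=> w; rewrite LqZ indE// mulr_ge0.
- by rewrite scalerA; exact: tailS.
- move=> Y tY; rewrite scalerA rho_average_ind//.
  by rewrite expectation_Lq_scale expectation_ind// (mulrA k).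
Qed.

Lemma averages0 : averages 0.
Proof.
have -> : 0 = 0 *: 1[S] :> L by rewrite scale0r.
exact: averages_ind.
Qed.

Lemma averagesD h1 h2 : averages h1 -> averages h2 -> averages (h1 + h2).
Proof.
move=> [h10 t1 e1] [h20 t2 e2]; split.
- by move=> w; rewrite LqD addr_ge0.
- by rewrite scalerDr; exact: ptailD.
- move=> Y tY; rewrite scalerDr addrA e2; last exact: ptailD.
  rewrite addrAC e1; last first.
    apply: ptailD => //; apply: tailS => //.
    by rewrite divr_ge0// ?pr_ge0// expectation_Lq_ge0.
  rewrite expectation_Lq_add; congr rho; apply/LfuneqP => w; rewrite !LqE; field.
  by rewrite gt_eqF.
Qed.

Import HBNNSimple.

(** Simple functions increasing to [h] are finite sums of indicators that can be averaged; both
    sides then pass to the limit by [rho_cvg]. *)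
Lemma rho_average Y h : ptail A Y -> (forall w, 0 <= h w) ->
  (forall w, ~ S w -> h w = 0) ->
  rho (Y + s *: h) = rho (Y + (s * (fine 'E_P[h] / pr P S)) *: 1[S]).
Proof.
move=> tY h0 hS.
have mh : measurable_fun setT (EFin \o h) by exact/measurable_EFinP.
pose g n := nnsfun_approx measurableT mh n.
have h0' w : [set: T] w -> (0 <= (EFin \o h) w)%E by move=> _; rewrite lee_fin.
have gh n w : g n w <= h w.
  rewrite -lee_fin /g nnsfun_approxE.
  exact: (@le_approx _ _ _ setT (EFin \o h)).
have g0 n w : 0 <= g n w by [].
have gL n : (g n : T -> R) \in Lfun P q%:E.
  apply: (@dominated_Lfun _ _ _ P q hq _ h) => // w.
  by rewrite !ger0_norm.
pose hn n : L := Lfun_Sub hq (gL n).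
have avg n : averages (hn n).
  have -> : hn n = \sum_(y <- fset_set (range (g n))) y *: 1[g n @^-1` [set y]].
    apply/LfuneqP => w.
    have -> : (\sum_(y <- fset_set (range (g n))) y *: 1[g n @^-1` [set y]]) w =
      \sum_(y <- fset_set (range (g n))) y * \1_(g n @^-1` [set y]) w.
      elim: (enum_fset _) => [|y l IHl]; first by rewrite !big_nil Lq0.
      by rewrite !big_cons LqD IHl LqZ indE//; exact: measurable_funPTI.
    by rewrite -fsbig_finite// -fimfunE.
  apply: (@big_ind _ averages).
  - exact: averages0.
  - exact: averagesD.
  (* A positive level set lies in [S] because [g n <= h] and [h] vanishes off [S]. The other levels
     contribute 0: a negative one is empty. *)
  move=> y _; have [y0|y0] := ltP 0 y.
    apply: averages_ind => //; last exact: ltW.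
    move=> w /= gy; apply: contrapT => /hS hw.
    by have := gh n w; rewrite gy hw leNgt y0.
  rewrite (_ : _ *: _ = 0); first exact: averages0.
  apply/LfuneqP => w; rewrite LqZ.
  have [->|yn0] := eqVneq y 0; first by rewrite mul0r.
  rewrite ind_out ?mulr0// => /= gy.
  by have := g0 n w; rewrite gy leNgt lt_neqAle yn0 y0.
have cg w : hn n w @[n --> \oo] --> h w.
  have : ((EFin \o g ^~ w) n @[n --> \oo] --> (h w)%:E)%E.
    exact: cvg_nnsfun_approx.
  by move=> /fine_cvgP[_].
have cE : fine 'E_P[hn n] @[n --> \oo] --> fine 'E_P[h].
  apply: (expectation_cvg cg (G := h)) => n w.
  by rewrite ger0_norm ?gh// g0.
have lhs : rho (Y + s *: hn n) @[n --> \oo] --> rho (Y + s *: h).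
  apply: (@rho_cvg _ _ _ _ _ _ _ hrho _ _ (`|s| *: h)).
    by move=> w; apply: cvgD; [exact: cvg_cst|apply: cvgMr; exact: cg].
  move=> n w; rewrite !LqE.
  rewrite [X in `|X|](_ : _ = s * (hn n w - h w)); last by ring.
  rewrite normrM ler_wpM2l// distrC ger0_norm ?subr_ge0 ?gh//.
  by rewrite lerBlDr lerDl g0.
have rhs : rho (Y + (s * (fine 'E_P[hn n] / pr P S)) *: 1[S]) @[n --> \oo] -->
   rho (Y + (s * (fine 'E_P[h] / pr P S)) *: 1[S]).
  apply: (@rho_cvg _ _ _ _ _ _ _ hrho _ _
    ((`|s| * (fine 'E_P[h] / pr P S)) *: 1[S])).
    move=> w; apply: cvgD; first exact: cvg_cst.
    by apply: cvgMl; apply: cvgMr; apply: cvgMl.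
  move=> n w; rewrite !LqE.
  rewrite [X in `|X|](_ : _ =
    s * ((fine 'E_P[hn n] - fine 'E_P[h]) / pr P S * 1[S] w)); last by ring.
  rewrite normrM -[leRHS]mulrA ler_wpM2l//.
  have iS : 0 <= 1[S] w by rewrite indE.
  rewrite normrM (ger0_norm iS) ler_wpM2r// normrM.
  rewrite (@ger0_norm _ (pr P S)^-1) ?invr_ge0 ?pr_ge0//.
  rewrite ler_wpM2r ?invr_ge0 ?pr_ge0//.
  rewrite distrC ger0_norm; last first.
    by rewrite subr_ge0; apply: le_expectation_Lq => v; exact: gh.
  by rewrite lerBlDr lerDl expectation_Lq_ge0// => v; exact: g0.
have lhs' : rho (Y + s *: hn n) @[n --> \oo] -->
    rho (Y + (s * (fine 'E_P[h] / pr P S)) *: 1[S]).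
  apply: cvg_trans rhs; apply: near_eq_cvg.
  by apply: nearW => n /=; have [_ _ ->] := avg n.
exact: (cvg_unique _ lhs lhs').
Qed.

End averaging_over_a_block.

End fixed_tail_event.

End averaging.

(** * Representation *)

Section representation.
Context {d : measure_display} {T : measurableType d} {R : realType}.
Variable P : probability T R.
Hypothesis hP : atomless P.
Variable p : R.
Hypotheses (p0 : 0 < p) (p1 : p < 1).
Variables (q : R) (hq : (1 <= q%:E)%E).
Local Notation L := (LfunType P hq).
Local Notation "1[ B ]" := (ind P hq B) (at level 0, format "1[ B ]").
Variables (rho : L -> R) (hrho : Lq_continuous rho).
Variable A0 : set T.
Hypotheses (mA0 : measurable A0) (PA0 : pr P A0 = 1 - p).

Let onep0 : 0 < 1 - p. Proof. by rewrite subr_gt0. Qed.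
Let PCA0 : pr P (~` A0) = p. Proof. by rewrite prC// PA0 subKr. Qed.

(* The random variable equal to x on A0 with mean y. *)
Definition two_valued (z : R * R) : L :=
  (z.1 - (z.1 - z.2) / p) *: 1[setT] + ((z.1 - z.2) / p) *: 1[A0].

Lemma two_valuedE z w :
  two_valued z w = z.1 - (z.1 - z.2) / p + (z.1 - z.2) / p * 1[A0] w.
Proof. by rewrite /two_valued !LqE ind_in// mulr1. Qed.

Lemma continuous_two_valued : continuous (fun z => rho (two_valued z)).
Proof.
move=> z; apply/cvgrPdist_lt => e e0.
have [delta dp h] := rho_sup_continuous hrho (two_valued z) e0.
(* In sup norm [two_valued] is Lipschitz: the first coordinate contributes [eta], and each of the
   two terms in [D] contributes at most [2 eta / p]. *)
pose eta := delta / (1 + 4 / p).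
have c0 : 0 < 1 + 4 / p by rewrite addr_gt0// divr_gt0.
have eta0 : 0 < eta by rewrite divr_gt0.
have /cvgrPdist_le/(_ _ eta0) near1 : z'.1 @[z' --> z] --> z.1 by exact: cvg_fst.
have /cvgrPdist_le/(_ _ eta0) near2 : z'.2 @[z' --> z] --> z.2 by exact: cvg_snd.
near=> z'; rewrite distrC; apply: h => w.
have h1 : `|z.1 - z'.1| <= eta by near: z'.
have h2 : `|z.2 - z'.2| <= eta by near: z'.
have -> : delta = eta + (eta + eta) / p + (eta + eta) / p.
  by rewrite /eta; field; rewrite !gt_eqF//= addr_gt0.
rewrite !two_valuedE.
pose D := ((z'.1 - z.1) - (z'.2 - z.2)) / p.
have hD : `|D| <= (eta + eta) / p.
  rewrite normrM [X in _ * X]gtr0_norm ?invr_gt0//.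
  rewrite ler_wpM2r ?invr_ge0 ?(ltW p0)//.
  by rewrite (le_trans (ler_normB _ _))// lerD// distrC.
rewrite [X in `|X|](_ : _ = (z'.1 - z.1) - D + D * 1[A0] w); last first.
  by rewrite /D; ring.
rewrite (le_trans (ler_normD _ _))// lerD//.
  by rewrite (le_trans (ler_normB _ _))// lerD// distrC.
rewrite normrM (le_trans _ hD)// ler_piMr// indE//.
by case: (_ \in _); rewrite ?normr1 ?normr0.
Unshelve. all: by end_near. Qed.

(** On [A0] the value [x] does not depend on [y]; off [A0] the value [x - (x - y) / p] increases
    with [y]. *)
Lemma monotone_two_valued : monotone_rm rho ->
  increasing_snd (fun z => rho (two_valued z)).
Proof.
move=> hM x y y' _ _ yy'; apply: hM => w; rewrite !two_valuedE/= indE//.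
case: (_ \in _); rewrite ?mulr1 ?mulr0 ?subrK// !addr0.
by rewrite lerD2l lerN2 ler_wpM2r ?invr_ge0 ?(ltW p0)// lerD2l lerN2.
Qed.

Hypothesis hCA : p_CA rho p.

Let ind_CA0 w : 1[~` A0] w = 1 - 1[A0] w.
Proof.
rewrite !indE//; last exact: measurableC.
by rewrite in_setC; case: (_ \in _); rewrite /= ?subrr ?subr0.
Qed.

(** Each inequality is a swap whose target is its own tail event: [A0] for one direction, [A] for
    the other. *)
Lemma rho_two_valued_invariant A b k : measurable A -> pr P A = 1 - p -> 0 <= k ->
  rho (b *: 1[setT] + k *: 1[A]) = rho (b *: 1[setT] + k *: 1[A0]).
Proof.
move=> mA PA k0; apply/eqP; rewrite eq_le; apply/andP; split.
- apply: (rho_swap_le p0 p1 hCA mA0 PA0) => //; last by rewrite PA.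
    exact: ptail_cst.
  exact: ptail_ind_in.
- apply: (rho_swap_le p0 p1 hCA mA PA) => //; last by rewrite PA.
    exact: ptail_cst.
  exact: ptail_ind_in.
Qed.

Lemma tail_in A : measurable A -> forall k B,
  measurable B -> B `<=` A -> 0 <= k -> ptail A ((1 * k) *: 1[B]).
Proof. by move=> mA k B mB BA k0; rewrite mul1r; exact: ptail_ind_in. Qed.

Lemma tail_out A : measurable A -> forall k B,
  measurable B -> B `<=` ~` A -> 0 <= k -> ptail A ((-1 * k) *: 1[B]).
Proof. by move=> mA k B mB BA k0; rewrite mulN1r; exact: ptail_ind_out. Qed.

Lemma rho_representation (X : L) :
  rho X = rho (two_valued (ES P p X, fine 'E_P[X])).
Proof.
set c := VaR P p X.
have [A [mA PA hA hCA']] := exists_VaR_tail hP p0 p1 X.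
have mCA : measurable (~` A) by exact: measurableC.
have PCA : pr P (~` A) = p by rewrite prC// PA subKr.
pose G : L := X - c *: 1[setT].
have GE w : G w = X w - c by rewrite /G !LqE ind_in// mulr1.
have mG : measurable_fun setT (X \- cst c) by exact: measurable_funB.
have [Lp Lm] : (X \- cst c)^\+ \in Lfun P q%:E /\ (X \- cst c)^\- \in Lfun P q%:E.
  split; apply: (@dominated_Lfun _ _ _ P q hq _ G).
  - exact: measurable_funrpos.
  - move=> w; rewrite GE ger0_norm ?funrpos_ge0//.
    rewrite /funrpos/= ge_max normr_ge0 andbT.
    exact: ler_norm.
  - exact: measurable_funrneg.
  - move=> w; rewrite GE ger0_norm ?funrneg_ge0//.
    rewrite /funrneg/= ge_max normr_ge0 andbT.
    by rewrite -normrN ler_norm.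
pose hp : L := Lfun_Sub hq Lp; pose hm : L := Lfun_Sub hq Lm.
have hp0 w : 0 <= hp w by exact: funrpos_ge0.
have hm0 w : 0 <= hm w by exact: funrneg_ge0.
have hpA w : ~ A w -> hp w = 0.
  by move=> /hCA' h; rewrite /hp/= /funrpos/= max_r// subr_le0.
have hmA w : A w -> hm w = 0.
  by move=> /hA h; rewrite /hm/= /funrneg/= max_r// oppr_le0 subr_ge0.
(* The excess [hp] over the quantile lives on [A] and the shortfall [hm] off [A], so each can be
   averaged over its own block. *)
have XE : X = c *: 1[setT] + -1 *: hm + 1 *: hp.
  apply/LfuneqP => w; rewrite !LqE ind_in// mulr1 mul1r mulN1r.
  have : hp w - hm w = X w - c.
    exact: (congr1 (@^~ w) (funrposBneg (X \- cst c))).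
  by lra.
have EX : fine 'E_P[X] = c - fine 'E_P[hm] + fine 'E_P[hp].
  rewrite {1}XE !expectation_Lq_add !expectation_Lq_scale expectation_ind//.
  by rewrite pr_setT; ring.
have ESX : (1 - p) * ES P p X = (1 - p) * c + fine 'E_P[hp].
  by rewrite ES_excess//; [rewrite expectation_Rintegral|exact: Lq_integrable].
have tm : ptail A (c *: 1[setT] + -1 *: hm).
  apply: ptailD; first exact: ptail_cst.
  by move=> w w' Aw _; rewrite !LqZ (hmA _ Aw) mulr0 mulN1r oppr_le0.
rewrite {1}XE (rho_average hP p0 p1 hrho hCA mA PA mA _ (tail_in mA))//;
  last by rewrite PA.
rewrite addrAC (rho_average hP p0 p1 hrho hCA mA PA mCA _ (tail_out mA))//;
  last first.
- by move=> w nA; apply: hmA; exact: contrapT.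
- apply: ptailD; first exact: ptail_cst.
  by apply: tail_in => //; rewrite divr_ge0 ?pr_ge0// expectation_Lq_ge0.
- by rewrite PCA.
(* After averaging, the variable is [c + a] on [A] and [c - m] off it. Thus [c + a] is the ES, and
   [ES - E = p (a + m)], as in [two_valued]. *)
set a := fine 'E_P[hp] / pr P A; set m := fine 'E_P[hm] / pr P (~` A).
have a0 : 0 <= a by rewrite divr_ge0 ?pr_ge0// expectation_Lq_ge0.
have m0 : 0 <= m by rewrite divr_ge0 ?pr_ge0// expectation_Lq_ge0.
transitivity (rho ((c - m) *: 1[setT] + (a + m) *: 1[A])).
  congr rho; apply/LfuneqP => w; rewrite !LqE.
  have -> : 1[~` A] w = 1[setT] w - 1[A] w.
    by rewrite !indE// in_setC in_setT; case: (_ \in _); rewrite /= ?subrr ?subr0.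
  ring.
rewrite rho_two_valued_invariant ?addr_ge0// /two_valued/=.
have aE : (1 - p) * a = fine 'E_P[hp] by rewrite /a PA mulrC divfK// gt_eqF.
have mE : p * m = fine 'E_P[hm] by rewrite /m PCA mulrC divfK// gt_eqF.
have ESE : ES P p X = c + a.
  by apply: (mulfI (lt0r_neq0 onep0)); rewrite ESX -aE mulrDr.
have kE : (ES P p X - fine 'E_P[X]) / p = a + m.
  apply: (canLR (mulfK _)); first by rewrite gt_eqF.
  by rewrite EX ESE -aE -mE; ring.
by rewrite kE ESE; congr (rho (_ *: _ + _)); ring.
Qed.

Lemma two_valued_increasing_fst : increasing_fst (fun z => rho (two_valued z)).
Proof.
move=> x x' y; rewrite /HH/= => yx yx' xx'.
have pp : 0 <= p * (1 - p) by rewrite mulr_ge0 ?ltW.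
have mCA0 : measurable (~` A0) by exact: measurableC.
(* The probability [p (1 - p)] fits into both blocks: [B] is the fraction [p] of [A0], and [C] the
   fraction [1 - p] of its complement. *)
have [|B [mB BA PB]] := atomless_subset hP mA0 pp.
  by rewrite PA0 ger_pMl// ltW.
have [|C [mC CA PC]] := atomless_subset hP mCA0 pp.
  by rewrite PCA0 ger_pMr// gerBl ltW.
(* [k] is the jump of [two_valued (x, y)]. Moving [K] from [C] to [B] and averaging raises the value
   on [A0] by [K p = x' - x] and keeps the mean [y]. *)
pose k := (x - y) / p; pose K := (x' - x) / p.
have k0 : 0 <= k by rewrite divr_ge0 ?subr_ge0 ?(ltW p0).
have K0 : 0 <= K by rewrite divr_ge0 ?subr_ge0 ?(ltW p0).
pose Z : L := (x - k) *: 1[setT] + k *: 1[A0].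
have tZ : ptail A0 Z by apply: ptailD; [exact: ptail_cst|exact: ptail_ind_in].
apply: (@le_trans _ _ (rho ((Z + (-1 * K) *: 1[C]) + K *: 1[B]))).
  rewrite [leLHS](_ : _ = rho ((Z + (-1 * K) *: 1[C]) + K *: 1[C])).
    apply: (rho_swap_le p0 p1 hCA mA0 PA0) => //; last by rewrite PB.
    - by apply: ptailD => //; exact: tail_out.
    - exact: ptail_ind_in.
  by congr rho; apply/LfuneqP => w; rewrite /two_valued !LqE/= -/k; ring.
rewrite -[K in K *: 1[B]]mul1r.
rewrite (rho_average_ind hP p0 p1 hrho hCA mA0 PA0 mA0 _ (tail_in mA0))//;
  last 2 first.
- by rewrite PA0.
- by apply: ptailD => //; exact: tail_out.
rewrite addrAC.
rewrite (rho_average_ind hP p0 p1 hrho hCA mA0 PA0 mCA0 _ (tail_out mA0))//;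
  last 2 first.
- by rewrite PCA0.
- apply: ptailD => //; apply: tail_in => //.
  by rewrite mulr_ge0// divr_ge0 ?pr_ge0.
rewrite PB PC PA0 PCA0 le_eqVlt; apply/orP; left; apply/eqP.
congr rho; apply/LfuneqP => w; rewrite two_valuedE !LqE/= ind_CA0 ind_in// /k /K.
by field; rewrite !gt_eqF.
Qed.

End representation.

Theorem proposition4 (d : measure_display) (T : measurableType d)
    (R : realType) (P : probability T R) (hP : atomless P)
    (p : R) (hp0 : 0 < p) (hp1 : p < 1)
    (q : R) (hq : (1 <= q%:E)%E)
    (rho : LfunType P hq -> R) (hrho : Lq_continuous rho) :
  (p_CA rho p <->
     exists f : R * R -> R,
       [/\ {within HH R, continuous f},
           increasing_fst f &
           forall X : LfunType P hq, rho X = f (ES P p X, fine 'E_P[X])]) /\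
  (monotone_rm rho /\ p_CA rho p <->
     exists f : R * R -> R,
       [/\ {within HH R, continuous f},
           increasing_fst f, increasing_snd f &
           forall X : LfunType P hq, rho X = f (ES P p X, fine 'E_P[X])]).
Proof.
have [|||A0 [mA0 _ PA0]] := @atomless_subset _ _ _ P hP setT (1 - p).
- by [].
- by rewrite subr_ge0 ltW.
- by rewrite pr_setT gerBl ltW.
pose f z := rho (two_valued P p hq A0 z).
have cf : {within HH R, continuous f}.
  by apply: continuous_subspaceT; exact: continuous_two_valued.
(* The mean of a sum depends only on the two laws, so passing to a concentrated pair changes only
   the ES coordinate, which increases. *)
have CA_of f' : increasing_fst f' ->
    (forall X : LfunType P hq, rho X = f' (ES P p X, fine 'E_P[X])) -> p_CA rho p.
  move=> f'1 f'E X Y X' Y' conc eX eY; rewrite !f'E.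
  have EE : fine 'E_P[X + Y] = fine 'E_P[X' + Y'].
    rewrite !expectation_Lq_add.
    by rewrite (eq_in_law_expectation eX) (eq_in_law_expectation eY).
  rewrite EE; apply: f'1.
  - by rewrite -EE; exact: (expectation_le_ES hP hp0 hp1 (X + Y)).
  - exact: (expectation_le_ES hP hp0 hp1 (X' + Y')).
  - exact: le_ES_concentrated.
split; split.
- move=> hCA; exists f; split => //.
  + exact: two_valued_increasing_fst.
  + by move=> X; exact: rho_representation.
- by move=> [f' [_ f'1 f'E]]; exact: CA_of f'1 f'E.
- move=> [hM hCA]; exists f; split => //.
  + exact: two_valued_increasing_fst.
  + exact: monotone_two_valued.
  + by move=> X; exact: rho_representation.
- move=> [f' [_ f'1 f'2 f'E]]; split; last exact: CA_of f'1 f'E.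
  move=> X Y XY; rewrite !f'E.
  have hXY := le_expectation_Lq XY; have hES := le_ES hP hp0 hp1 XY.
  have hX := expectation_le_ES hP hp0 hp1 X.
  have hY := expectation_le_ES hP hp0 hp1 Y.
  (* The coordinates are increased one at a time, ES first: this corner stays in [HH] because
     [E X <= ES X <= ES Y]. *)
  apply: (@le_trans _ _ (f' (ES P p Y, fine 'E_P[X]))).
    by apply: f'1 => //; exact: le_trans hX hES.
  by apply: f'2 => //; exact: le_trans hX hES.
Qed.
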